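(* Let $e,m,n$ be integers with $2\le m<n\le e-2$, let $k$ be a field, and let $I^e(m,n)$ be the defining ideal of the numerical semigroup ring $k[S^e(m,n)]$. Then the minimal number of generators of $I^e(m,n)$ is $$\mu(I^e(m,n))=\begin{cases}\binom{e-2}{2}, & (m,n)\in\{(2,4),(2,5),(3,4)\},\\[2pt] \binom{e-2}{2}-1, & m=2 \text{ and } (n=3 \text{ or } n\ge 6),\\[2pt] \binom{e-2}{2}-2, & \text{otherwise.}\end{cases}$$
   Context: For integers $e,m,n$ with $2\le m<n\le e-2$, $S^e(m,n)$ denotes the Sally type numerical semigroup, i.e. the numerical semigroup (submonoid of $(\mathbb N,+)$, with $0\in\mathbb N$) minimally generated by $\{e,e+1,\ldots,2e-1\}\setminus\{e+m,e+n\}$. Put $J=\{0,1,\ldots,e-1\}\setminus\{m,n\}$ and $A=k[X_i : i\in J]$, a polynomial ring in $e-2$ variables. The semigroup ring is $k[S^e(m,n)]=k[t^{e+i} : i\in J]\subset k[t]$, and the defining ideal $I^e(m,n)$ is the kernel of the $k$-algebra homomorphism $\phi:A\to k[t]$, $\phi(X_i)=t^{e+i}$. The ideal $I^e(m,n)$ is homogeneous for the grading $\deg X_i=e+i$; $\mu(I^e(m,n))$ denotes its minimal number of generators, i.e. the number of elements in a minimal homogeneous generating set, equivalently $\dim_k I^e(m,n)/\mathfrak m I^e(m,n)$ where $\mathfrak m=(X_i : i\in J)$. This is also the first Betti number of $k[S^e(m,n)]$ over $A$. *)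

(* Defs.v *)
From HB Require Import structures.
From mathcomp Require Import all_boot all_order all_algebra.
From mathcomp Require Export mpoly.

Set Implicit Arguments.
Unset Strict Implicit.
Unset Printing Implicit Defensive.

Import GRing.Theory.
Local Open Scope ring_scope.

(* A numerical semigroup is given by the increasing list [a] of its minimal
   generators; the variable 'X_i of {mpoly k[size a]} corresponds to the
   generator [nth 0 a i]. *)

Definition semigroup_gen (a : seq nat) (i : 'I_(size a)) : nat := nth 0%N a i.

Definition toric_map (k : fieldType) (a : seq nat)
    (p : {mpoly k[size a]}) : {poly k} :=
  mmap (@polyC k) (fun i => 'X^(semigroup_gen i)) p.

Definition defining_ideal (k : fieldType) (a : seq nat) :
    pred {mpoly k[size a]} :=
  fun p => toric_map p == 0.

(* The grading in which 'X_i has degree [w i]. *)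
Definition weighted_deg (N : nat) (w : 'I_N -> nat) (u : 'X_{1..N}) : nat :=
  (\sum_(i < N) u i * w i)%N.

Definition weighted_homogeneous (k : fieldType) (N : nat) (w : 'I_N -> nat)
    (p : {mpoly k[N]}) : Prop :=
  exists d : nat, forall u, u \in msupp p -> weighted_deg w u = d.

Definition generates_ideal (R : comNzRingType) (I : pred R) (s : seq R) :
    Prop :=
  forall p : R,
    p \in I <-> exists c : 'I_(size s) -> R, p = \sum_(i < size s) c i * s`_i.

Definition hom_generating_set (k : fieldType) (N : nat) (w : 'I_N -> nat)
    (I : pred {mpoly k[N]}) (s : seq {mpoly k[N]}) : Prop :=
  [/\ uniq s,
      forall f, f \in s -> weighted_homogeneous w f
    & generates_ideal I s].

Definition minimal_hom_generating_set (k : fieldType) (N : nat)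
    (w : 'I_N -> nat) (I : pred {mpoly k[N]}) (s : seq {mpoly k[N]}) : Prop :=
  hom_generating_set w I s /\
  forall s' : seq {mpoly k[N]},
    {subset s' <= s} -> hom_generating_set w I s' -> {subset s <= s'}.

(* mu(I) = r.  That the number of elements does not depend on the minimal
   homogeneous generating set is part of the assertion. *)
Definition min_number_of_generators (k : fieldType) (N : nat)
    (w : 'I_N -> nat) (I : pred {mpoly k[N]}) (r : nat) : Prop :=
  (exists s, minimal_hom_generating_set w I s) /\
  (forall s, minimal_hom_generating_set w I s -> size s = r).

(* {e, e+1, ..., 2e-1} \ {e+m, e+n}, the minimal generators of S^e(m,n). *)
Definition sally_gens (e m n : nat) : seq nat :=
  [seq x <- iota e e | (x != e + m)%N && (x != e + n)%N].

Definition sally_ideal (k : fieldType) (e m n : nat) :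
    pred {mpoly k[size (sally_gens e m n)]} :=
  defining_ideal (k := k) (a := sally_gens e m n).

(* Main.v *)
Require Import Defs.
From mathcomp Require Import all_boot all_order all_algebra.
From mathcomp Require Import zify.
From HB Require Import structures.

(** Write J for the set of offsets {0, ..., e-1} minus {m, n}, so that the
    variables are the X_j with j in J, of degree e+j.

    Minimal generators of a toric ideal.  Let U be a finite set of monomials,
    and attach to every degree d a monomial nf(d).  Suppose that every proper
    divisor of a monomial of U is the only monomial of its degree.  A
    polynomial of I has coefficient 0 at such a monomial, so for u in U the
    coefficient at u vanishes on M.I, where M is the ideal of the variables.
    If moreover nf never takes values in U, the coefficients at U separate the
    binomials u - nf(deg u), which are thus independent modulo M.I.  If finally
    these binomials rewrite every monomial to the normal form of its degree,
    they generate I, and so mu(I) = |U| ([toric_min_number_of_generators]).  To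
    compare an arbitrary minimal homogeneous generating set s with the
    binomials F, express each in terms of the other; the matrices of constant
    terms of the coefficients are inverse to each other.  One product is 1 by
    looking at the coefficients at U; were the other different from 1, the
    homogeneous components of the resulting relation among the elements of s
    would exhibit one of them as redundant ([homogeneous_relation]).

    The set U for Sally type semigroups.  The Apery set of the semigroup with
    respect to e consists of 0, the generators e+j for j in J nonzero, and one
    element in each of the residue classes of m and n.  These last two are
    represented by X_1 X_(m-1) and by X_1 X_(n-1), or X_2 X_(m-1) when n = m+1;
    for (m,n) = (2,3) no product of two variables works for n and X_1^3 takes
    its place.  The normal form of a degree is a power of X_0 times such an
    Apery monomial.  U consists of all products of two variables other than X_0
    that are not Apery monomials, together with a few exceptional cubics: X_1^3
    if m = 2 < n-1, also X_1^2 X_3 for (2,4) and X_1^2 X_4 for (2,5), and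
    X_1 X_2^2, X_2^3 for (3,4).  There are C(e-2,2) products of two variables,
    which gives the formula.

    That the binomials rewrite every monomial to its normal form is proved by
    induction on the degree: outside the case (2,3) it suffices to rewrite a
    product of three variables other than X_0 into a multiple of X_0
    ([triple_reducible]).  A product X_a X_b whose sum a+b is neither m nor n
    is already equivalent to such a multiple, so only triples whose three
    pairwise sums all lie in {m,n} matter.  Such a triple is of the form a, b,
    b, and after replacing one pair by another one with the same sum a pair
    with a harmless sum appears, unless the triple is one of the exceptional
    cubics, which have a binomial of their own ([triple_repeated]).  In the
    case (2,3) the products with a+b = e+3 are equivalent to X_1^3 instead, and
    X_1^3 is in normal form, so that products of four variables enter as well
    ([triple_reducible23], [quadruple_reducible23]). *)

Set Implicit Arguments.
Unset Strict Implicit.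
Unset Printing Implicit Defensive.

Import GRing.Theory.

(** * Ideals given by lists of generators *)

Local Open Scope ring_scope.

Definition in_ideal (R : comNzRingType) (s : seq R) (p : R) : Prop :=
  exists c : 'I_(size s) -> R, p = \sum_(i < size s) c i * s`_i.

Section Ideal.
Context (R : comNzRingType).
Implicit Types (s t : seq R) (p q : R).

Lemma in_ideal0 s : in_ideal s 0.
Proof. by exists (fun=> 0); rewrite big1 // => i _; rewrite mul0r. Qed.

Lemma in_idealD s p q : in_ideal s p -> in_ideal s q -> in_ideal s (p + q).
Proof.
move=> [c ->] [d ->]; exists (fun i => c i + d i).
by rewrite -big_split; apply: eq_bigr => i _; rewrite mulrDl.
Qed.

Lemma in_idealM s p q : in_ideal s q -> in_ideal s (p * q).
Proof.
move=> [c ->]; exists (fun i => p * c i).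
by rewrite mulr_sumr; apply: eq_bigr => i _; rewrite mulrA.
Qed.

Lemma in_idealN s p : in_ideal s p -> in_ideal s (- p).
Proof. by rewrite -mulN1r; apply: in_idealM. Qed.

Lemma in_ideal_sum s (J : Type) (r : seq J) (P : pred J) (F : J -> R) :
  (forall i, P i -> in_ideal s (F i)) -> in_ideal s (\sum_(i <- r | P i) F i).
Proof.
by move=> sF; elim/big_rec: _ => [|i q /sF]; [apply: in_ideal0 | apply: in_idealD].
Qed.

Lemma in_ideal_gen s p : p \in s -> in_ideal s p.
Proof.
move=> sp; have ip : (index p s < size s)%N by rewrite index_mem.
exists (fun i => (i == Ordinal ip)%:R); rewrite (bigD1 (Ordinal ip)) //=.
rewrite eqxx mul1r nth_index // big1 ?addr0 // => i /negPf->.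
by rewrite mul0r.
Qed.

Lemma in_ideal_trans s t p :
  (forall g, g \in s -> in_ideal t g) -> in_ideal s p -> in_ideal t p.
Proof.
move=> st [c ->]; apply: in_ideal_sum => i _.
by apply/in_idealM/st/mem_nth.
Qed.

(** The form in which minimality of a generating set gets contradicted: a
    generator that is a combination of the others can be dropped. *)
Lemma in_ideal_rem s (j : 'I_(size s)) (c : 'I_(size s) -> R) : uniq s ->
  s`_j = \sum_(i < size s | i != j) c i * s`_i -> in_ideal (rem s`_j s) s`_j.
Proof.
move=> us {2}->; apply: in_ideal_sum => i ij.
apply/in_idealM/in_ideal_gen.
by rewrite mem_rem_uniq // inE mem_nth // nth_uniq // ij.
Qed.

End Ideal.

(** * Weighted homogeneous relations *)

Section Weighted.
Context (k : fieldType) (N : nat) (w : 'I_N -> nat).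
Local Notation wdeg := (weighted_deg w).

Lemma weighted_deg0 : wdeg 0%MM = 0%N.
Proof. by rewrite /weighted_deg big1 // => i _; rewrite mnm0E. Qed.

Lemma weighted_degD : {morph wdeg : u v / (u + v)%MM >-> (u + v)%N}.
Proof.
move=> u v; rewrite /weighted_deg -big_split; apply: eq_bigr => i _.
by rewrite mnmDE mulnDl.
Qed.

HB.instance Definition _ :=
  isMeasure.Build N (weighted_deg w) weighted_deg0 weighted_degD.

(** The degree of a homogeneous polynomial is that of its leading monomial,
    which names it uniformly (for the zero polynomial every degree would do). *)
Lemma weighted_homogeneousP (p : {mpoly k[N]}) : weighted_homogeneous w p ->
  p \is ishomog1 (wdeg (mlead p)) (weighted_deg w : measure N).
Proof.
move=> [d dp]; apply/dhomogP => u up.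
have p0 : p != 0 by apply: contraTneq up => ->; rewrite msupp0.
exact: etrans (dp _ up) (esym (dp _ (mlead_supp p0))).
Qed.

Lemma mcoeff_pihomog (mf : measure N) d (p : {mpoly k[N]}) u :
  (pihomog mf d p)@_u = if mf u == d then p@_u else 0.
Proof.
rewrite pihomogE linear_sum big_mkcond /= [p in RHS]mpolyE linear_sum /=.
transitivity (\sum_(i <- msupp p) if mf u == d then (p@_i *: 'X_[i])@_u else 0).
  apply: eq_bigr => i _; rewrite mcoeffZ mcoeffX.
  by case: (eqVneq i u) => [->//|_]; rewrite mulr0; do 2!case: ifP.
by case: ifP => // _; rewrite big1.
Qed.

Lemma pihomogM_dhomog d e (p q : {mpoly k[N]}) :
  q \is ishomog1 d (weighted_deg w : measure N) ->
  pihomog (weighted_deg w : measure N) e (p * q) =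
  (if (d <= e)%N then pihomog (weighted_deg w : measure N) (e - d) p else 0) * q.
Proof.
move=> qd; rewrite {1 2}[p]mpolyE mulr_suml !linear_sum /=.
have -> : (if (d <= e)%N then \sum_(m <- msupp p)
    pihomog (weighted_deg w : measure N) (e - d) (p@_m *: 'X_[m]) else 0) =
  \sum_(m <- msupp p) (if (d <= e)%N then
    pihomog (weighted_deg w : measure N) (e - d) (p@_m *: 'X_[m]) else 0).
  by case: ifP => // _; rewrite big1.
rewrite mulr_suml; apply: eq_bigr => m _.
rewrite -scalerAl !linearZ /=.
have mq : 'X_[m] * q \is ishomog1 (wdeg m + d) (weighted_deg w : measure N).
  by apply: dhomogM => //; rewrite dhomogX.
have [->|ne] := eqVneq e (wdeg m + d)%N.
  by rewrite leq_addl addnK pihomogX eqxx (pihomog_dE mq) scalerAl.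
rewrite (pihomog_ne0 _ mq) 1?eq_sym // scaler0.
case: leqP => // de; last by rewrite mul0r.
rewrite pihomogX ifF ?scaler0 ?mul0r //; apply/negP => /eqP E.
by case/eqP: ne; rewrite [wdeg m]E subnK.
Qed.

Hypothesis w_gt0 : forall i, (0 < w i)%N.

Lemma weighted_deg_eq0 u : wdeg u = 0%N -> u = 0%MM.
Proof.
move/eqP; rewrite sum_nat_eq0 => /forallP u0; apply/mnmP => i.
have := u0 i; rewrite implyTb muln_eq0 mnm0E => /orP [/eqP //|].
by move/eqP => wi; have := w_gt0 i; rewrite wi.
Qed.

(** Graded form of Nakayama's lemma: take the component of the relation in the
    degree of [s`_j].  Since only constants have degree 0, the coefficient of
    [s`_j] there is the constant term of [h j], which can be inverted. *)
Lemma homogeneous_relation (s : seq {mpoly k[N]}) (j : 'I_(size s))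
    (h : 'I_(size s) -> {mpoly k[N]}) :
  (forall f, f \in s -> weighted_homogeneous w f) ->
  \sum_(i < size s) h i * s`_i = 0 -> (h j)@_0%MM != 0 ->
  exists c : 'I_(size s) -> {mpoly k[N]},
    s`_j = \sum_(i < size s | i != j) c i * s`_i.
Proof.
move=> homs h0 hj.
pose d i := wdeg (mlead s`_i).
have homd (i : 'I_(size s)) : s`_i \is ishomog1 (d i) (weighted_deg w : measure N).
  by apply/weighted_homogeneousP/homs/mem_nth.
pose H (i : 'I_(size s)) := if (d i <= d j)%N
  then pihomog (weighted_deg w : measure N) (d j - d i) (h i) else 0.
have H0 : \sum_(i < size s) H i * s`_i = 0.
  have := congr1 (pihomog (weighted_deg w : measure N) (d j)) h0.
  rewrite linear_sum linear0 /= => E; rewrite -[RHS]E; apply: eq_bigr => i _.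
  by rewrite (pihomogM_dhomog _ _ (homd i)).
have Hj : H j = ((h j)@_0%MM)%:MP.
  rewrite /H leqnn subnn; apply/mpolyP => u; rewrite mcoeffC.
  have [->|u0] := eqVneq u 0%MM; last first.
    rewrite mulr0; apply: (dhomog_nemf_coeff (pihomogP _ 0 (h j))).
    by apply: contra_neq u0; apply: weighted_deg_eq0.
  by rewrite mulr1 mcoeff_pihomog mf0.
exists (fun i => - ((h j)@_0%MM)^-1 *: H i).
apply: (scalerI hj); rewrite -mul_mpolyC -Hj.
move: H0; rewrite (bigD1 j) //= => /eqP; rewrite addr_eq0 => /eqP ->.
rewrite scaler_sumr -sumrN; apply: eq_bigr => i _.
by rewrite -scalerAl scalerA mulrN divff // scaleN1r.
Qed.

End Weighted.

(** * Minimal generators of a toric ideal *)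

Section Toric.
Context (k : fieldType) (a : seq nat).
Local Notation w := (@semigroup_gen a).
Local Notation wdeg := (weighted_deg w).
Local Notation I := (@defining_ideal k a).
Implicit Types (p q : {mpoly k[size a]}) (u v : 'X_{1..size a}).

Definition unique_factorization u := forall v, wdeg v = wdeg u -> v = u.

Lemma toric_mapX u : toric_map 'X_[k, u] = 'X^(wdeg u).
Proof.
rewrite /toric_map mmapX /mmap1 /weighted_deg -prodrXr.
by apply: eq_bigr => i _; rewrite -exprM mulnC.
Qed.

Lemma toric_mapE p : toric_map p = \sum_(u <- msupp p) p@_u *: 'X^(wdeg u).
Proof.
rewrite [p in LHS]mpolyE /toric_map raddf_sum; apply: eq_bigr => u _ /=.
by rewrite mmapZ [mmap _ _ _]toric_mapX mul_polyC.
Qed.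

Lemma mem_toric_ideal p : (p \in I) = (toric_map p == 0).
Proof. by []. Qed.

Lemma toric_idealD p q : p \in I -> q \in I -> p + q \in I.
Proof.
by rewrite !mem_toric_ideal /toric_map mmapD => /eqP -> /eqP ->; rewrite addr0.
Qed.

Lemma toric_idealM p q : q \in I -> p * q \in I.
Proof. by rewrite !mem_toric_ideal /toric_map rmorphM /= => /eqP ->; rewrite mulr0. Qed.

Lemma toric_ideal_in_ideal s p : {subset s <= I} -> in_ideal s p -> p \in I.
Proof.
move=> sI [c ->]; elim/big_rec: _ => [|i q _]; last first.
  by apply/toric_idealD/toric_idealM/sI/mem_nth.
by rewrite mem_toric_ideal /toric_map mmap0.
Qed.

Lemma binomial_toric_ideal u v : wdeg u = wdeg v -> 'X_[k, u] - 'X_[v] \in I.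
Proof.
move=> uv; rewrite mem_toric_ideal /toric_map mmapB.
by rewrite ![mmap _ _ _]toric_mapX uv subrr.
Qed.

(** Compare coefficients of the power of the variable whose exponent is the
    degree of [u]: on the toric side only [u] contributes to it. *)
Lemma mcoeff_unique_factorization p u :
  p \in I -> unique_factorization u -> p@_u = 0.
Proof.
rewrite mem_toric_ideal => /eqP /(congr1 (fun q : {poly k} => q`_(wdeg u))) + uu.
rewrite toric_mapE coef_sum coef0 [X in _ -> X@_u = _]mpolyE linear_sum /= => E.
rewrite -[RHS]E; apply: eq_bigr => v _; rewrite coefZ coefXn mcoeffZ mcoeffX.
congr (_ * _%:R); congr nat_of_bool; apply/eqP/eqP => [-> //|/esym /uu //].
Qed.

(** [U] are the leading monomials of the generators to be, [nf d] is the
    intended normal form of the monomials of degree [d].  That the binomials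
    [u - nf (wdeg u)] rewrite everything is stated through an arbitrary
    congruence on monomials, so that this combinatorial condition can be
    verified without reference to polynomials. *)
Context (U : seq 'X_{1..size a}) (nf : nat -> 'X_{1..size a}).
Hypothesis a_gt0 : all (leq 1) a.
Hypothesis U_uniq : uniq U.
Hypothesis U_quotient : forall u i, u \in U -> (U_(i) <= u)%MM ->
  unique_factorization (u - U_(i))%MM.
Hypothesis nf_notin : forall u, u \in U -> nf (wdeg u) \notin U.
Hypothesis nf_deg : forall u, u \in U -> wdeg (nf (wdeg u)) = wdeg u.
Hypothesis nf_congruence : forall E : 'X_{1..size a} -> 'X_{1..size a} -> Prop,
  (forall u, E u u) -> (forall u v, E u v -> E v u) ->
  (forall u v t, E u v -> E v t -> E u t) ->
  (forall u v t, E u v -> E (t + u)%MM (t + v)%MM) ->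
  (forall u, u \in U -> E u (nf (wdeg u))) ->
  forall u, E u (nf (wdeg u)).

Let w_gt0 i : (0 < w i)%N.
Proof. by have /all_nthP := a_gt0; apply. Qed.

Definition toric_binomial u := 'X_[k, u] - 'X_[nf (wdeg u)].

Let F := map toric_binomial U.

Lemma toric_binomial_coeff u v : u \in U -> v \in U ->
  (toric_binomial u)@_v = (u == v)%:R.
Proof.
move=> uU vU; rewrite mcoeffB !mcoeffX.
case: (nf _ =P v) => [nfv|_]; last by rewrite subr0.
by have := nf_notin uU; rewrite nfv vU.
Qed.

Lemma toric_binomials_sub : {subset F <= I}.
Proof. by move=> _ /mapP [u uU ->]; rewrite binomial_toric_ideal // nf_deg. Qed.

Lemma toric_binomials_nf u : in_ideal F (toric_binomial u).
Proof.
apply: (nf_congruence (E := fun u v => in_ideal F ('X_[k, u] - 'X_[v]))) => //.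
- by move=> v; rewrite subrr; apply: in_ideal0.
- by move=> v t /in_idealN; rewrite opprB.
- by move=> v t z /in_idealD /[apply]; rewrite addrA subrK.
- by move=> v t z vt; rewrite !mpolyXD -mulrBr; apply: in_idealM.
- by move=> v vU; apply/in_ideal_gen/map_f.
Qed.

(** Modulo the binomials, [p] becomes the combination of the monomials
    [nf d] whose coefficients are those of [toric_map p], that is, zero. *)
Lemma toric_binomials_generate p : p \in I -> in_ideal F p.
Proof.
rewrite mem_toric_ideal => /eqP p0.
pose psi (q : {poly k}) := \sum_(d < size q) q`_d *: 'X_[k, nf d].
have psiE K (q : {poly k}) : (size q <= K)%N ->
    psi q = \sum_(d < K) q`_d *: 'X_[nf d].
  move=> qK; rewrite /psi (big_ord_widen _ (fun d => q`_d *: 'X_[nf d]) qK).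
  rewrite big_mkcond; apply: eq_bigr => d _; case: ltnP => // qd.
  by rewrite nth_default ?scale0r.
have nf0 : \sum_(u <- msupp p) p@_u *: 'X_[k, nf (wdeg u)] = 0.
  pose K := (\max_(u <- msupp p) (wdeg u).+1)%N.
  transitivity (psi (toric_map p)); last by rewrite p0 /psi size_poly0 big_ord0.
  have pK : (size (toric_map p) <= K)%N.
    rewrite toric_mapE; apply: leq_trans (size_sum _ _ _) _.
    apply/bigmax_leqP_seq => u up _; apply: leq_trans (size_scale_leq _ _) _.
    rewrite size_polyXn; exact: (leq_bigmax_seq (F := fun u => (wdeg u).+1)).
  rewrite (psiE _ _ pK) toric_mapE.
  under [RHS]eq_bigr => d _ do rewrite coef_sum scaler_suml.
  rewrite exchange_big /=; apply: eq_big_seq => u up.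
  have uK : (wdeg u < K)%N by exact: (leq_bigmax_seq (F := fun u => (wdeg u).+1)).
  rewrite (bigD1 (Ordinal uK)) //= coefZ coefXn eqxx mulr1 big1 ?addr0 // => d.
  rewrite -val_eqE /= coefZ coefXn => /negPf ->.
  by rewrite mulr0 scale0r.
rewrite [p]mpolyE -[X in in_ideal _ X]subr0 -[X in _ - X]nf0 -sumrB.
apply: in_ideal_sum => u _; rewrite -scalerBr -mul_mpolyC.
exact/in_idealM/toric_binomials_nf.
Qed.

(** In degree [u] only the constant term of [c] counts: every other term pairs
    with the coefficient of [g] at a proper divisor of [u], which vanishes. *)
Lemma mcoeffM_toric_ideal c g u : u \in U -> g \in I ->
  (c * g)@_u = c@_0%MM * g@_u.
Proof.
move=> uU gI.
have proper v t : u = (t + v)%MM -> t != 0%MM -> g@_v = 0.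
  move=> uE t0; apply: mcoeff_unique_factorization => // v' v'v.
  have [i ti] : exists i, t i != 0%N.
    apply/existsP; apply: contraNT t0 => /existsPn t0; apply/eqP/mnmP => i.
    by rewrite mnm0E; apply/eqP; rewrite -[_ == _]negbK t0.
  have iu : (U_(i) <= u)%MM by rewrite lep1mP uE mnmDE; move: ti; clear; lia.
  have uiE : (u - U_(i) = (t - U_(i)) + v)%MM.
    rewrite uE; apply/mnmP => j; rewrite mnmBE !mnmDE mnmBE mnm1E.
    by case: eqP => [<-|_]; move: ti; clear; lia.
  apply: (@addmI _ (t - U_(i))%MM); rewrite -uiE.
  by apply: (U_quotient uU iu); rewrite uiE !weighted_degD v'v.
have [->|g0] := eqVneq g 0; first by rewrite mulr0 mcoeff0 mulr0.
rewrite [c in LHS]mpolyE mulr_suml linear_sum /=.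
have -> : c@_0%MM * g@_u = \sum_(t <- msupp c) (c@_t * (t == 0%MM)%:R) * g@_u.
  rewrite -mulr_suml [X in X@_0%MM]mpolyE linear_sum /=; congr (_ * _).
  by apply: eq_bigr => t _; rewrite mcoeffZ mcoeffX.
apply: eq_bigr => t _; rewrite -scalerAl mcoeffZ -mulrA; congr (_ * _).
case: eqP => [->|/eqP t0]; first by rewrite mpolyX0 !mul1r.
rewrite mul0r mulrC; case tu : (t <= u)%MM.
  by rewrite -(submK tu) addmC mcoeffMX (proper _ t) // addmC submK.
apply/eqP; rewrite mcoeff_eq0 (perm_mem (msuppMX _ _)).
by apply/negP => /mapP [v _ uE]; rewrite uE lem_addr in tu.
Qed.

Lemma mcoeff_comb s (c : 'I_(size s) -> {mpoly k[size a]}) u :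
  u \in U -> {subset s <= I} ->
  (\sum_(i < size s) c i * s`_i)@_u = \sum_(i < size s) (c i)@_0%MM * (s`_i)@_u.
Proof.
move=> uU sI; rewrite linear_sum; apply: eq_bigr => i _.
by rewrite /= mcoeffM_toric_ideal // sI // mem_nth.
Qed.

Lemma generatesP s : generates_ideal I s <->
  {subset s <= I} /\ forall p, p \in I -> in_ideal s p.
Proof.
split=> [gI|[sI Is] p]; last first.
  by split=> [/Is //|]; apply: toric_ideal_in_ideal.
by split=> [p ps|p /gI //]; apply/gI/in_ideal_gen.
Qed.

Lemma toric_binomials_uniq : uniq F.
Proof.
rewrite map_inj_in_uniq // => u v uU vU E.
apply/eqP; have := toric_binomial_coeff uU vU.
rewrite E toric_binomial_coeff // eqxx; case: eqP => // _ /eqP.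
by rewrite oner_eq0.
Qed.

Lemma toric_binomials_minimal : minimal_hom_generating_set w I F.
Proof.
split.
  split; first exact: toric_binomials_uniq.
    move=> _ /mapP [u uU ->]; exists (wdeg u) => v /msuppB_le.
    rewrite mem_cat !msuppX !inE => /orP [] /eqP -> //; exact: nf_deg.
  by apply/generatesP; split;
     [exact: toric_binomials_sub | exact: toric_binomials_generate].
move=> s sF [_ _ /generatesP [sI Is]] _ /mapP [u uU ->].
have [c E] := Is _ (toric_binomials_sub (map_f _ uU)).
apply/negPn/negP => us; have := toric_binomial_coeff uU uU.
rewrite E mcoeff_comb // eqxx big1 => [/esym/eqP|i _]; first by rewrite oner_eq0.
have /mapP [v vU iE] := sF _ (mem_nth 0 (ltn_ord i)).
rewrite iE toric_binomial_coeff //; case: eqP => [vu|]; last by rewrite mulr0.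
by case/negP: us; rewrite -vu -iE mem_nth.
Qed.

(** Take the constant terms of the coefficients that express [s] through the
    binomials and conversely.  The coefficients at [U] give [L *m M = 1%:M]; an
    entry where [M *m L] differs from the identity is the constant term in a
    relation that makes an element of [s] redundant. *)
Lemma minimal_generators_size s : minimal_hom_generating_set w I s -> size s = size U.
Proof.
move=> [[us homs /generatesP [sI Is]] smin].
have [D DE] : exists D, forall i : 'I_(size s),
    s`_i = \sum_(j < size F) (D i : 'I_(size F) -> {mpoly k[size a]}) j * F`_j.
  apply: (fin_all_exists (P := fun (i : 'I_(size s)) d =>
    s`_i = \sum_(j < size F) (d : 'I_(size F) -> {mpoly k[size a]}) j * F`_j)) => i.
  by have [d E] := toric_binomials_generate (sI _ (mem_nth 0 (ltn_ord i))); exists d.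
have [C CE] : exists C, forall j : 'I_(size F),
    F`_j = \sum_(i < size s) (C j : 'I_(size s) -> {mpoly k[size a]}) i * s`_i.
  apply: (fin_all_exists (P := fun (j : 'I_(size F)) c =>
    F`_j = \sum_(i < size s) (c : 'I_(size s) -> {mpoly k[size a]}) i * s`_i)) => j.
  by have [c E] := Is _ (toric_binomials_sub (mem_nth 0 (ltn_ord j))); exists c.
pose M := \matrix_(i, j) (D i j)@_0%MM; pose L := \matrix_(j, i) (C j i)@_0%MM.
have szF : size F = size U by rewrite size_map.
have FE (j : 'I_(size F)) : F`_j = toric_binomial (nth 0%MM U j).
  by rewrite (nth_map 0%MM) // -szF.
have Uj (j : 'I_(size F)) : nth 0%MM U j \in U by rewrite mem_nth // -szF.
have Fcoeff (i j : 'I_(size F)) : (F`_i)@_(nth 0%MM U j) = (i == j)%:R.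
  by rewrite FE toric_binomial_coeff // nth_uniq // -szF.
have LM : L *m M = 1%:M.
  apply/matrixP => j j'; rewrite !mxE -Fcoeff CE mcoeff_comb //.
  apply: eq_bigr => i _; rewrite !mxE; congr (_ * _).
  rewrite DE mcoeff_comb //; last exact: toric_binomials_sub.
  rewrite (bigD1 j') //= Fcoeff eqxx mulr1 big1 ?addr0 // => l /negPf lj.
  by rewrite Fcoeff lj mulr0.
have ML : M *m L = 1%:M.
  apply/matrixP => i l; apply/eqP/negPn/negP => ne.
  pose h l' := \sum_j D i j * C j l' - (i == l')%:R%:MP.
  have h0 : \sum_(l' < size s) h l' * s`_l' = 0.
    transitivity (\sum_(j < size F) D i j * F`_j - s`_i); last by rewrite -DE subrr.
    under eq_bigr => l' _ do rewrite mulrBl.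
    rewrite sumrB; congr (_ - _).
      under eq_bigr => l' _ do rewrite mulr_suml.
      rewrite exchange_big; apply: eq_bigr => j _.
      by rewrite CE mulr_sumr; apply: eq_bigr => l' _; rewrite mulrA.
    rewrite (bigD1 i) //= eqxx mul1r big1 ?addr0 // => l' /negPf.
    by rewrite eq_sym => ->; rewrite mpolyC0 mul0r.
  have hl : (h l)@_0%MM != 0.
    apply: contraNneq ne; rewrite mcoeffB mcoeffC eqxx mulr1 => /subr0_eq.
    rewrite !mxE => <-; rewrite linear_sum; apply/eqP/eq_bigr => j _.
    by rewrite !mxE rmorphM.
  have [c E] := homogeneous_relation w_gt0 homs h0 hl.
  have su := in_ideal_rem us E.
  suff : s`_l \in rem s`_l s by rewrite mem_rem_uniq // !inE eqxx.
  apply: (smin (rem s`_l s)) (mem_nth _ _) => //; first by move=> x /mem_rem.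
  split; [exact: rem_uniq | by move=> f /mem_rem; apply: homs | ].
  apply/generatesP; split=> [x /mem_rem /sI //|p /Is].
  apply: in_ideal_trans => g gs; have [-> //|gl] := eqVneq g s`_l.
  by apply: in_ideal_gen; rewrite mem_rem_uniq // !inE gl.
by apply/eqP; rewrite -szF eqn_leq (mulmx1_min ML) (mulmx1_min LM).
Qed.

Theorem toric_min_number_of_generators :
  min_number_of_generators w I (size U).
Proof.
split; last exact: minimal_generators_size.
by exists F; apply: toric_binomials_minimal.
Qed.

End Toric.

Local Open Scope nat_scope.

(** * Unordered pairs *)

Fixpoint upairs (s : seq nat) : seq (seq nat) :=
  if s is x :: s' then [seq [:: x; y] | y <- s] ++ upairs s' else [::].

Lemma size_upairs s : size (upairs s) = 'C((size s).+1, 2).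
Proof.
elim: s => [|x s IH] //=; rewrite size_cat size_map IH.
by rewrite [in RHS]binS bin1 -addSn addnC.
Qed.

Lemma upairsP s t : sorted ltn s ->
  reflect (exists a b, [/\ t = [:: a; b], a \in s, b \in s & a <= b])
    (t \in upairs s).
Proof.
move=> ss; apply: (iffP idP).
  elim: s ss => [|x s IH] //= ss.
  have xs := order_path_min ltn_trans ss.
  rewrite inE mem_cat => /or3P [/eqP ->|/mapP [y ys ->]|].
  - by exists x, x; rewrite !inE eqxx.
  - by exists x, y; rewrite !inE eqxx ys orbT (ltnW (allP xs y ys)).
  move/(IH (path_sorted ss)) => [a [b [-> sa sb ab]]].
  by exists a, b; rewrite !inE sa sb !orbT.
move=> [a [b [-> sa sb ab]]]; elim: s ss sa sb => [|x s IH] //= ss.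
have xs := order_path_min ltn_trans ss.
rewrite !inE mem_cat => /orP [/eqP ax|sa] /orP [/eqP bx|sb].
- by rewrite ax bx eqxx.
- by rewrite ax map_f // orbT.
- by have := allP xs a sa; rewrite /= ltnNge -bx ab.
- by rewrite (IH (path_sorted ss)) ?orbT.
Qed.

Lemma uniq_upairs s : sorted ltn s -> uniq (upairs s).
Proof.
elim: s => [|x s IH] //= ss; have xs := order_path_min ltn_trans ss.
rewrite cat_uniq IH ?(path_sorted ss) // map_inj_uniq => [|y z [] //].
have xNs : x \notin s by apply/negP => /(allP xs) /=; rewrite ltnn.
have us : uniq s := sorted_uniq ltn_trans ltnn (path_sorted ss).
rewrite us andbT mem_cat negb_or.
have NP t : head 0 t = x -> t \notin upairs s.
  move=> tx; apply/(upairsP _ (path_sorted ss)) => -[a [b [tE sa _ _]]].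
  by rewrite tE /= in tx; rewrite -tx sa in xNs.
rewrite (NP [:: x; x]) // andbT; apply/andP; split.
  by apply/mapP => -[y ys [xy]]; rewrite xy ys in xNs.
apply/hasPn => t tU; apply/mapP => -[y _ tE].
by move: tU; rewrite tE (negPf (NP _ _)).
Qed.

(** * Monomials as words of offsets *)

Section Words.
Context (e m n : nat).
Hypothesis m_ge2 : 2 <= m.
Hypothesis mn : m < n.
Hypothesis n_le : n <= e - 2.

Local Notation G := (sally_gens e m n).
Local Notation w := (@semigroup_gen G).

Definition offset (j : nat) := [&& j < e, j != m & j != n].

Lemma mem_sally_gens x : (x \in G) = (e <= x) && offset (x - e).
Proof. by rewrite mem_filter mem_iota /offset; move: m_ge2 mn n_le; lia. Qed.

Lemma sally_gens_uniq : uniq G.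
Proof. exact/filter_uniq/iota_uniq. Qed.

Lemma sally_gens_gt0 : all (leq 1) G.
Proof. by apply/allP => x; rewrite mem_sally_gens /=; move: m_ge2 mn n_le; lia. Qed.

(** A word is a list of offsets, standing up to permutation for the product of
    the corresponding variables; this is the degree of that product. *)
Definition word_deg (s : seq nat) := e * size s + sumn s.

Lemma word_deg_cons x s : word_deg (x :: s) = e + x + word_deg s.
Proof. by rewrite /word_deg /= mulnS; lia. Qed.

Lemma word_deg_cat s t : word_deg (s ++ t) = word_deg s + word_deg t.
Proof. by rewrite /word_deg size_cat sumn_cat mulnDr; lia. Qed.

Lemma perm_word_deg s t : perm_eq s t -> word_deg s = word_deg t.
Proof. by move=> st; rewrite /word_deg (perm_size st) (perm_sumn st). Qed.

Definition mono (s : seq nat) : 'X_{1..size G} :=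
  [multinom count_mem (nth 0 G i - e) s | i < size G].

Lemma mono_cat s t : mono (s ++ t) = (mono s + mono t)%MM.
Proof. by apply/mnmP => i; rewrite mnmDE !mnmE count_cat. Qed.

Lemma mono_nil : mono [::] = 0%MM.
Proof. by apply/mnmP => i; rewrite !mnm0E. Qed.

Lemma perm_mono s t : perm_eq s t -> mono s = mono t.
Proof. by move=> /permP st; apply/mnmP => i; rewrite !mnmE st. Qed.

Lemma nth_gens (i : 'I_(size G)) : e <= nth 0 G i /\ offset (nth 0 G i - e).
Proof.
by apply/andP; rewrite -mem_sally_gens mem_nth.
Qed.

Lemma gens_offset_inj (i j : 'I_(size G)) :
  (nth 0 G i - e == nth 0 G j - e) = (i == j).
Proof.
have [[ei _] [ej _]] := (nth_gens i, nth_gens j).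
by rewrite -(eqn_add2r e) !subnK // nth_uniq ?sally_gens_uniq.
Qed.

Lemma offset_index j : offset j -> exists i : 'I_(size G), nth 0 G i - e = j.
Proof.
move=> oj; have jG : e + j \in G by rewrite mem_sally_gens leq_addr addKn.
have iG : index (e + j) G < size G by rewrite index_mem.
by exists (Ordinal iG); rewrite /= nth_index // addKn.
Qed.

Lemma mono_inj s t : all offset s -> all offset t -> mono s = mono t ->
  perm_eq s t.
Proof.
move=> os ot st; apply/allP => x; rewrite mem_cat => xst.
have /offset_index [i <-] : offset x.
  by case/orP: xst => [/(allP os)|/(allP ot)].
by move/mnmP: st => /(_ i); rewrite !mnmE /= => ->.
Qed.

Lemma mono_deg s : all offset s -> weighted_deg w (mono s) = word_deg s.
Proof.
elim: s => [|x s IH] /=.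
  by rewrite mono_nil weighted_deg0 /word_deg muln0.
move=> /andP [ox /IH {}IH]; rewrite -cat1s mono_cat weighted_degD IH.
rewrite word_deg_cat; congr (_ + _).
have [i ix] := offset_index ox; have [ei _] := nth_gens i.
rewrite /weighted_deg (bigD1 i) //= big1 => [|j ji].
  by rewrite mnmE /= -ix eqxx /semigroup_gen /word_deg /=; lia.
by rewrite mnmE /= -ix gens_offset_inj eq_sym (negPf ji).
Qed.

Lemma mono_surj u : exists2 s, all offset s & u = mono s.
Proof.
rewrite [u]multinomUE_id; elim/big_ind: _.
- by exists [::]; rewrite ?mono_nil.
- move=> _ _ [s os ->] [t ot ->]; exists (s ++ t); last by rewrite mono_cat.
  by rewrite all_cat os.
move=> i _; have [_ oi] := nth_gens i.
exists (nseq (u i) (nth 0 G i - e)); first by rewrite all_nseq oi orbT.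
apply/mnmP => j; rewrite mulmnE mnm1E mnmE count_nseq /= gens_offset_inj.
by case: eqP.
Qed.

Lemma mono_rem s i : (U_(i) <= mono s)%MM ->
  (nth 0 G i - e \in s) /\ (mono s - U_(i))%MM = mono (rem (nth 0 G i - e) s).
Proof.
rewrite lep1mP mnmE -lt0n -has_count has_pred1 => xs; split=> //.
apply/mnmP => j; rewrite mnmBE mnm1E !mnmE count_rem xs /=.
by rewrite gens_offset_inj.
Qed.

(** * Normal forms and critical words *)

(** The Apery monomial in the residue class of [n].  The pair 1, n-1 is
    unavailable when n-1 = m, and 2, n-2 in turn when m = 2. *)
Definition top_word :=
  if n == m.+1 then if m == 2 then [:: 1; 1; 1] else [:: 2; m.-1]
  else [:: 1; n.-1].

Definition apery_word r :=
  if r == 0 then [::] else if r == m then [:: 1; m.-1]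
  else if r == n then top_word else [:: r].

(** If [d] lies in the semigroup, the exponent of X_0 makes the length of the
    word equal to [d %/ e], and its degree equal to [d]. *)
Definition normal_word d :=
  nseq (d %/ e - size (apery_word (d %% e))) 0 ++ apery_word (d %% e).

(** The triples all of whose pairs are Apery pairs with no other factorization,
    so that no quadratic binomial applies to them.  For (2,3) the only such
    triple 1, 1, 1 is an Apery word. *)
Definition critical_cubics :=
  if m == 2 then
    if n == 3 then [::]
    else [:: 1; 1; 1] :: (if n == 4 then [:: [:: 1; 1; 3]]
                          else if n == 5 then [:: [:: 1; 1; 4]] else [::])
  else if (m == 3) && (n == 4) then [:: [:: 1; 2; 2]; [:: 2; 2; 2]] else [::].

Definition positive_offsets := [seq j <- iota 1 e.-1 | (j != m) && (j != n)].

Definition critical_words :=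
  [seq s <- upairs positive_offsets | s \notin [:: apery_word m; apery_word n]]
  ++ critical_cubics.

Lemma mem_positive_offsets j :
  (j \in positive_offsets) = (0 < j) && offset j.
Proof. by rewrite mem_filter mem_iota /offset; move: m_ge2 mn n_le; lia. Qed.

Lemma sorted_positive_offsets : sorted ltn positive_offsets.
Proof. exact/(sorted_filter ltn_trans)/iota_ltn_sorted. Qed.

Lemma size_positive_offsets : size positive_offsets = e - 3.
Proof.
have P : perm_eq (iota 1 e.-1) [:: m, n & positive_offsets].
  apply: uniq_perm; first exact: iota_uniq.
    rewrite /= !inE !mem_filter !eqxx /= andbF orbF filter_uniq ?iota_uniq //.
    by rewrite andbT; move: mn; lia.
  by move=> x; rewrite !inE mem_filter mem_iota; move: m_ge2 mn n_le; lia.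
have := perm_size P; rewrite size_iota /=; move: m_ge2 mn n_le; lia.
Qed.

Lemma apery_word_m : apery_word m = [:: 1; m.-1].
Proof. by rewrite /apery_word eqxx ifN //; move: m_ge2; lia. Qed.

Lemma apery_word_n : apery_word n = top_word.
Proof. by rewrite /apery_word eqxx !ifN //; move: m_ge2 mn; lia. Qed.

Lemma sumn_apery_word r : sumn (apery_word r) = r.
Proof.
rewrite /apery_word /top_word.
by do !case: ifP; rewrite /=; move: m_ge2 mn; lia.
Qed.

Lemma apery_word_offset r : r < e -> all offset (apery_word r).
Proof.
rewrite /apery_word /top_word /offset => re.
by do !case: ifP; rewrite /=; move: m_ge2 mn n_le re; lia.
Qed.

Lemma e_gt0 : 0 < e.
Proof. by move: m_ge2 mn n_le; lia. Qed.

Lemma normal_word_offset d : all offset (normal_word d).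
Proof.
rewrite all_cat all_nseq apery_word_offset ?ltn_mod ?e_gt0 // andbT.
by rewrite /offset; move: m_ge2 mn n_le; lia.
Qed.

Lemma normal_wordE q r : r < e ->
  normal_word (e * q + r) = nseq (q - size (apery_word r)) 0 ++ apery_word r.
Proof.
move=> re; rewrite /normal_word mulnC modnMDl divnMDl ?e_gt0 //.
by rewrite modn_small // divn_small // addn0.
Qed.

Lemma normal_word_deg q r : r < e -> size (apery_word r) <= q ->
  word_deg (normal_word (e * q + r)) = e * q + r.
Proof.
move=> re rq; rewrite normal_wordE // /word_deg size_cat size_nseq subnK //.
by rewrite sumn_cat sumn_nseq mul0n sumn_apery_word.
Qed.

Lemma normal_word_shift q r : r < e ->
  normal_word (word_deg (nseq q 0 ++ apery_word r)) = nseq q 0 ++ apery_word r.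
Proof.
move=> re; rewrite /word_deg size_cat size_nseq sumn_cat sumn_nseq mul0n add0n.
by rewrite sumn_apery_word normal_wordE // addnK.
Qed.

Lemma apery_word_big r : 1 < size (apery_word r) -> r = m \/ r = n.
Proof.
by rewrite /apery_word; do !case: ifP => // /eqP; [left | right].
Qed.

Lemma size_apery_word r : size (apery_word r) <= 3.
Proof. by rewrite /apery_word /top_word; do !case: ifP. Qed.

Lemma size_apery_word_le2 r : (n != 3) || (r != 3) -> size (apery_word r) <= 2.
Proof.
rewrite /apery_word /top_word; do !case: ifP => //=; move: m_ge2 mn; lia.
Qed.

Lemma critical_wordsP s : s \in critical_words ->
  (exists a b, [/\ s = [:: a; b], a \in positive_offsets, b \in positive_offsets,
     a <= b & s \notin [:: apery_word m; apery_word n]]) \/ s \in critical_cubics.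
Proof.
rewrite mem_cat mem_filter => /orP [/andP [sN]|]; last by right.
move=> /(upairsP _ sorted_positive_offsets) [a [b [sE sa sb ab]]].
by left; exists a, b.
Qed.

Lemma critical_cubicsP (P : seq nat -> Prop) :
  (m = 2 -> n != 3 -> P [:: 1; 1; 1]) ->
  (m = 2 -> n = 4 -> P [:: 1; 1; 3]) ->
  (m = 2 -> n = 5 -> P [:: 1; 1; 4]) ->
  (m = 3 -> n = 4 -> P [:: 1; 2; 2]) ->
  (m = 3 -> n = 4 -> P [:: 2; 2; 2]) ->
  forall s, s \in critical_cubics -> P s.
Proof.
rewrite /critical_cubics => P1 P2 P3 P4 P5 s.
case: ifP => [/eqP m2|_]; last first.
  by case: ifP => [/andP [/eqP m3 /eqP n4]|//]; rewrite !inE => /orP [] /eqP ->; auto.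
case: ifP => // /negbT n3; rewrite inE => /orP [/eqP ->|]; first exact: P1.
case: ifP => [/eqP n4|_]; first by rewrite inE => /eqP ->; auto.
by case: ifP => [/eqP n5|//]; rewrite inE => /eqP ->; auto.
Qed.

Lemma critical_word_offset s : s \in critical_words ->
  [/\ all offset s, 0 \notin s, sorted leq s & 1 < size s].
Proof.
move=> /critical_wordsP [[a [b [-> + + ab _]]]|].
  rewrite !mem_positive_offsets /= => /andP [a0 ->] /andP [b0 ->].
  by rewrite !inE; split; move: a0 b0 ab; lia.
move: s; apply: critical_cubicsP; rewrite /= /offset;
  by move: m_ge2 mn n_le => ? ? ? *; split; rewrite ?inE //; lia.
Qed.

Lemma critical_words_mono_inj : {in critical_words &, injective mono}.
Proof.
move=> s t /critical_word_offset [os _ ss _] /critical_word_offset [ot _ st _].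
move=> /(mono_inj os ot) /(sorted_eq leq_trans anti_leq ss st) //.
Qed.

Lemma critical_words_uniq : uniq critical_words.
Proof.
rewrite cat_uniq filter_uniq ?uniq_upairs ?sorted_positive_offsets //=.
apply/andP; split.
  apply/hasPn => s sc; rewrite mem_filter negb_and.
  apply/orP; right; apply/(upairsP _ sorted_positive_offsets) => -[a [b [sE _ _ _]]].
  by move: s sc sE; apply: critical_cubicsP.
by rewrite /critical_cubics; do !case: ifP.
Qed.

(** A normal word contains the letter 0 or is an Apery word; critical words are
    neither. *)
Lemma normal_word_notin d : mono (normal_word d) \notin map mono critical_words.
Proof.
apply/mapP => -[s sc E].
have [os s0 ss s2] := critical_word_offset sc.
have := mono_inj (normal_word_offset d) os E.
have rd : d %% e < e by rewrite ltn_mod e_gt0.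
rewrite /normal_word; case: (d %/ e - _) => [|q]; last first.
  by move/perm_mem => /(_ 0); rewrite (negPf s0) inE.
rewrite /= => ps; have {ps} sE : s = apery_word (d %% e).
  apply/esym/(sorted_eq leq_trans anti_leq) => //.
  rewrite /apery_word /top_word.
  by do !case: ifP; rewrite /=; move: m_ge2 mn n_le rd; lia.
move: sc s2; rewrite mem_cat mem_filter => /orP [/andP [+ _]|].
  rewrite sE => + /apery_word_big [] rE; by rewrite rE !inE eqxx ?orbT.
move=> sc _; move: s sc sE {os s0 ss E}; apply: critical_cubicsP;
  rewrite /apery_word /top_word; move=> m2 n2; do !case: ifP => //; move: m2 n2;
  clear; lia.
Qed.

Lemma size_critical_words : size critical_words =
  if (m, n) \in [:: (2, 4); (2, 5); (3, 4)] then 'C(e - 2, 2)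
  else if (m == 2) && ((n == 3) || (6 <= n)) then 'C(e - 2, 2) - 1
  else 'C(e - 2, 2) - 2.
Proof.
pose reps := apery_word m :: (if n == 3 then [::] else [:: apery_word n]).
have Pos a b : a <= b -> 0 < a -> offset a -> offset b ->
    [:: a; b] \in upairs positive_offsets.
  move=> ab a0 oa ob; apply/(upairsP _ sorted_positive_offsets); exists a, b.
  by split=> //; rewrite mem_positive_offsets ?oa ?ob ?a0 ?(leq_trans a0 ab).
have mU : apery_word m \in upairs positive_offsets.
  by rewrite apery_word_m; apply: Pos; rewrite /offset; move: m_ge2 mn n_le; lia.
have nU : n != 3 -> apery_word n \in upairs positive_offsets.
  rewrite apery_word_n /top_word => n3; move: m_ge2 mn n_le => m2 n2 ne.
  case: ifP => nm; first (rewrite ifN; last by lia);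
    by apply: Pos; rewrite /offset; lia.
have P : perm_eq (upairs positive_offsets)
    (reps ++ [seq s <- upairs positive_offsets
             | s \notin [:: apery_word m; apery_word n]]).
  apply: uniq_perm; first exact/uniq_upairs/sorted_positive_offsets.
    rewrite cat_uniq filter_uniq ?uniq_upairs ?sorted_positive_offsets //= andbT.
    apply/andP; split.
      rewrite /reps; case: ifP => //= _; rewrite inE andbT.
      apply/eqP => /(congr1 sumn); rewrite !sumn_apery_word; move: mn; lia.
    apply/hasPn => s; rewrite mem_filter /reps => /andP [+ _].
    by case: ifP; rewrite !inE // negb_or => _ /andP [].
  move=> s; rewrite mem_cat mem_filter /reps.
  have [->|sm] := eqVneq s (apery_word m); first by rewrite mU inE eqxx.
  have [->|sn] := eqVneq s (apery_word n); last first.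
    by case: ifP; rewrite !inE (negPf sm) (negPf sn).
  case: ifP => [/eqP n3|/negbT n3]; last by rewrite nU // !inE eqxx orbT.
  have m2 : m = 2 by move: m_ge2 mn; lia.
  rewrite !inE eqxx orbT /= orbF apery_word_n apery_word_m /top_word n3 m2 /=.
  by apply/(upairsP _ sorted_positive_offsets) => -[a [b []]].
have := perm_size P; rewrite size_upairs size_positive_offsets !size_cat.
have -> : (e - 3).+1 = e - 2 by move: m_ge2 mn n_le; lia.
rewrite /reps /critical_cubics !inE !xpair_eqE => ->.
move: m_ge2 mn => m2 n2.
by do !case: ifP; rewrite /=; lia.
Qed.

Lemma one_letter_word t j : all offset t -> j < e -> word_deg t = e + j -> t = [:: j].
Proof.
rewrite /word_deg; case: t => [|y [|z t]] /=; [lia | | nia].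
by rewrite muln1 => _ _ /addnI; rewrite addn0 => ->.
Qed.

Lemma two_letter_word t c : all offset t -> c < e -> word_deg t = e * 2 + c ->
  exists y z, [/\ t = [:: y; z], offset y, offset z & y + z = c].
Proof.
rewrite /word_deg; case: t => [|y [|z [|x t]]] /=; rewrite /offset; try nia.
by move=> /and3P [oy oz _] ce E; exists y, z; split=> //; lia.
Qed.

(** The proper divisors of critical words have one letter, or two letters with
    a sum at most 5.  A generator factors in only one way, and each of the sums
    that occur is attained by a single pair of letters. *)
Lemma critical_word_quotient s x t : s \in critical_words -> x \in s ->
  all offset t -> word_deg t = word_deg (rem x s) -> perm_eq t (rem x s).
Proof.
move=> sc xs ot; move/critical_wordsP: sc xs => [[a [b [-> ]]]|].
  rewrite !mem_positive_offsets => /andP [_ oa] /andP [_ ob] _ _.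
  have [ae be] : a < e /\ b < e by case/and3P: oa; case/and3P: ob.
  rewrite !inE /= => /orP [] /eqP ->; rewrite ?eqxx; last case: ifP => _;
    by rewrite /word_deg /= addn0 muln1 => /(one_letter_word ot) ->.
have pairs c u v : c < e -> u + v = c ->
    (forall y z, offset y -> offset z -> y + z = c -> y <= z -> y = u) ->
    word_deg t = e * 2 + c -> perm_eq t [:: u; v].
  move=> ce uv H /(two_letter_word ot ce) [y [z [-> oy oz yz]]].
  have [yz'|zy'] := leqP y z.
    by rewrite (H y z) // (_ : z = v) //; move: yz uv (H y z oy oz yz yz'); lia.
  rewrite perm_sym (perm_catC [:: u] [:: v]) /=.
  have := H z y oz oy; rewrite addnC => /(_ yz (ltnW zy')) zu.
  by rewrite zu (_ : y = v) //; move: yz uv zu; lia.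
move: s; apply: critical_cubicsP => mE; rewrite ?mE => nE; rewrite ?nE !inE;
  do ?case/orP; move=> /eqP ->; rewrite /word_deg /= => D;
  apply: pairs D => //; rewrite /offset; move: mn n_le; lia.
Qed.

Lemma size_critical_cubic s : s \in critical_cubics -> size s = 3.
Proof. by move: s; apply: critical_cubicsP. Qed.

(** The bounds on the size of the Apery word say that the normal word has the
    right degree, and for the cubics that it contains the letter 0. *)
Lemma critical_word_deg s : s \in critical_words -> exists q r,
  [/\ word_deg s = e * q + r, r < e, size (apery_word r) <= q &
    s \in critical_cubics -> size (apery_word r) < q].
Proof.
have e0 := e_gt0.
move=> /critical_wordsP [[a [b [-> ]]]|].
  rewrite !mem_positive_offsets => /andP [a0 oa] /andP [b0 ob] _ _.
  have [ae be] : a < e /\ b < e by case/and3P: oa; case/and3P: ob.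
  have NC : [:: a; b] \in critical_cubics -> False.
    by move/size_critical_cubic.
  have [sm|sm] := ltnP (a + b) e.
    exists 2, (a + b); split=> //; first by rewrite /word_deg /= addn0.
    apply: size_apery_word_le2; move: oa ob a0 b0 m_ge2 mn; rewrite /offset; lia.
  exists 3, (a + b - e); split=> //; first by rewrite /word_deg /=; lia.
  - by move: ae be sm; clear; lia.
  - exact: size_apery_word.
have small q r s' : r < e -> r != m -> r != n -> 1 < q ->
    word_deg s' = e * q + r ->
    exists q r, [/\ word_deg s' = e * q + r, r < e, size (apery_word r) <= q &
    s' \in critical_cubics -> size (apery_word r) < q].
  move=> re rm rn q1 E; exists q, r; rewrite /apery_word (negPf rm) (negPf rn).
  by split=> //; case: ifP => _ /=; lia.
move: s; apply: critical_cubicsP => mE; rewrite ?mE => nE.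
- by apply: (small 3 3); rewrite ?mE ?nE //; move: n_le nE mn; lia.
- by apply: (small 3 5); rewrite ?mE ?nE //; move: n_le; lia.
- by apply: (small 3 6); rewrite ?mE ?nE //; move: n_le; lia.
- by apply: (small 3 5); rewrite ?mE ?nE //; move: n_le; lia.
(* The sum of the letters 2, 2, 2 is divisible by e exactly when e = 6. *)
have [e6|e6] := eqVneq e 6.
  by apply: (small 4 0); rewrite ?mE ?nE // /word_deg e6.
by apply: (small 3 6); rewrite ?mE ?nE //; move: n_le e6; lia.
Qed.

(** * Rewriting words to normal form *)

Section Congruence.
Context (E : 'X_{1..size G} -> 'X_{1..size G} -> Prop).
Hypothesis E_refl : forall u, E u u.
Hypothesis E_sym : forall u v, E u v -> E v u.
Hypothesis E_trans : forall u v t, E u v -> E v t -> E u t.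
Hypothesis E_add : forall u v t, E u v -> E (t + u)%MM (t + v)%MM.
Hypothesis E_critical : forall s, s \in critical_words ->
  E (mono s) (mono (normal_word (word_deg s))).

Definition equivalent s t := E (mono s) (mono t) /\ word_deg s = word_deg t.
Local Infix "=~" := equivalent (at level 70).

(** A reducible word is equivalent to one with a letter 0; dropping that letter
    lowers the degree, which drives the induction. *)
Definition reducible s := exists t, [/\ all offset t, 0 \in t & s =~ t].

Definition normalizable s := exists q r, r < e /\ s =~ nseq q 0 ++ apery_word r.

Lemma equivalent_perm s t : perm_eq s t -> s =~ t.
Proof.
by move=> st; rewrite /equivalent (perm_mono st) (perm_word_deg st).
Qed.

Lemma equivalent_refl s : s =~ s.
Proof. by split. Qed.

Lemma equivalent_trans t s v : s =~ t -> t =~ v -> s =~ v.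
Proof. by move=> [st sE] [tv tE]; split; [apply: E_trans st tv | rewrite sE]. Qed.

Lemma equivalent_sym s t : s =~ t -> t =~ s.
Proof. by move=> [st sE]; split; [apply: E_sym|]. Qed.

Lemma equivalent_cat v s t : s =~ t -> v ++ s =~ v ++ t.
Proof. by move=> [st d]; split; rewrite ?mono_cat ?word_deg_cat ?d //; apply: E_add. Qed.

Lemma critical_equivalent s : s \in critical_words -> s =~ normal_word (word_deg s).
Proof.
move=> sc; split; first exact: E_critical.
have [q [r [-> re rq _]]] := critical_word_deg sc.
by rewrite normal_word_deg.
Qed.

Lemma reducible_trans s t : s =~ t -> reducible t -> reducible s.
Proof. by move=> st [v [ov v0 tv]]; exists v; split=> //; apply: equivalent_trans tv. Qed.

Lemma reducible_cat v s : all offset v -> reducible s -> reducible (v ++ s).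
Proof.
move=> ov [t [ot t0 st]]; exists (v ++ t); rewrite all_cat ov ot mem_cat t0 orbT.
by split=> //; apply: equivalent_cat.
Qed.

Lemma reducible_perm s t : perm_eq s t -> reducible t -> reducible s.
Proof. by move/equivalent_perm; apply: reducible_trans. Qed.

Lemma normal_word_reducible s q r : s =~ normal_word (word_deg s) ->
  word_deg s = e * q + r -> r < e -> size (apery_word r) < q -> reducible s.
Proof.
move=> sN sE re rq; exists (normal_word (word_deg s)); split=> //.
  exact: normal_word_offset.
by rewrite sE normal_wordE // -(subnSK rq) inE eqxx.
Qed.

Lemma cubic_reducible s : s \in critical_cubics -> reducible s.
Proof.
move=> sc; have sw : s \in critical_words by rewrite mem_cat sc orbT.
have [q [r [sE re _ rq]]] := critical_word_deg sw.
exact: normal_word_reducible (critical_equivalent sw) sE re (rq sc).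
Qed.

Local Notation pos j := (j \in positive_offsets).

Lemma pair_equivalent a b : pos a -> pos b ->
  [:: a; b] =~ normal_word (word_deg [:: a; b]).
Proof.
wlog ab : a b / a <= b.
  move=> H pa pb; have [ab|/ltnW ba] := leqP a b; first exact: H.
  have pab : perm_eq [:: a; b] [:: b; a] by rewrite (perm_catC [:: a] [:: b]).
  rewrite (perm_word_deg pab).
  exact: equivalent_trans (equivalent_perm pab) (H _ _ ba pb pa).
move=> pa pb.
have [|abN] := boolP ([:: a; b] \in [:: apery_word m; apery_word n]).
  have me : m < e by move: mn n_le; lia.
  have ne : n < e by move: mn n_le; lia.
  by rewrite !inE => /orP [] /eqP ->;
     rewrite -[apery_word _]/(nseq 0 0 ++ apery_word _) normal_word_shift //;
     apply: equivalent_refl.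
apply: critical_equivalent; rewrite mem_cat mem_filter abN /=.
apply/orP; left; apply/(upairsP _ sorted_positive_offsets).
by exists a, b.
Qed.

(** Both pairs have the same degree, hence the same normal word. *)
Lemma pair_exchange a b c d : pos a -> pos b -> pos c -> pos d ->
  a + b = c + d -> [:: a; b] =~ [:: c; d].
Proof.
move=> pa pb pc pd abcd; apply: equivalent_trans (pair_equivalent pa pb) _.
have -> : word_deg [:: a; b] = word_deg [:: c; d].
  by rewrite /word_deg /= !addn0 abcd.
exact/equivalent_sym/pair_equivalent.
Qed.

(** The normal word of a pair has length 2 or 3 and the Apery word in it is
    shorter, except for the sums m and n, and for X_1^3 in the case (2,3),
    which has the same degree as the pairs with sum e+3. *)
Lemma pair_reducible a b : pos a -> pos b -> a + b != m -> a + b != n ->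
  ~~ ((n == 3) && (a + b == e + 3)) -> reducible [:: a; b].
Proof.
move=> pa pb abm abn ab3; have := pair_equivalent pa pb.
move: pa pb; rewrite !mem_positive_offsets => /andP [a0 oa] /andP [b0 ob] H.
have [ae be] : a < e /\ b < e by case/and3P: oa; case/and3P: ob.
have [lt|ge] := ltnP (a + b) e.
  apply: (normal_word_reducible (q := 2) (r := a + b) H) => //.
    by rewrite /word_deg /= addn0.
  by rewrite /apery_word (negPf abm) (negPf abn); case: ifP.
apply: (normal_word_reducible (q := 3) (r := a + b - e) H); rewrite /word_deg /=; try lia.
by rewrite ltnS size_apery_word_le2 //; move: ab3 ge; clear; lia.
Qed.

Lemma pos_offset j : pos j -> offset j.
Proof. by rewrite mem_positive_offsets => /andP []. Qed.

Lemma pair_cons_reducible x a b : pos x -> reducible [:: a; b] -> reducible [:: x; a; b].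
Proof.
move=> px; apply: (@reducible_cat [:: x]).
by rewrite /= pos_offset.
Qed.

Lemma triple_perm1 (a b c : nat) : perm_eq [:: a; b; c] [:: b; c; a].
Proof. by rewrite (perm_catC [:: a] [:: b; c]). Qed.

Section NotTwoThree.
Hypothesis n_neq3 : n != 3.

Lemma pair_reducible_generic a b : pos a -> pos b -> a + b != m -> a + b != n ->
  reducible [:: a; b].
Proof. by move=> *; apply: pair_reducible; rewrite ?(negPf n_neq3). Qed.

(** Replace the pair [b], [c] by [d], [f], then reduce the pair formed by [a]
    and one of the new letters. *)
Lemma triple_exchange a b c d f : pos a -> pos b -> pos c -> pos d -> pos f ->
  b + c = d + f ->
  (a + d != m) && (a + d != n) || (a + f != m) && (a + f != n) ->
  reducible [:: a; b; c].
Proof.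
move=> pa pb pc pd pf bcdf adf.
apply: (reducible_trans (t := [:: a; d; f])).
  exact: (equivalent_cat [:: a] (pair_exchange pb pc pd pf bcdf)).
case/orP: adf => /andP [Hm Hn].
  apply: (reducible_perm (t := [:: f; a; d])).
    by rewrite perm_sym; apply: triple_perm1.
  exact/pair_cons_reducible/pair_reducible_generic.
apply: (reducible_perm (t := [:: d; f; a])); first exact: triple_perm1.
by apply/pair_cons_reducible/pair_reducible_generic => //; rewrite addnC.
Qed.

(** If b+b = m, the new pair is b-1, b+1 (and 3, n-3 in place of 1, n-1 when
    m = 2); if b+b = n it is 1, n-1, or 2, n-2 when n-1 = m.  The cases in which
    these letters are not available are the exceptional cubics. *)
Lemma triple_repeated a b : pos a -> pos b ->
  (a + b == m) || (a + b == n) -> (b + b == m) || (b + b == n) ->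
  reducible [:: a; b; b].
Proof.
have posE j : pos j = (0 < j < e) && (j != m) && (j != n).
  by rewrite mem_positive_offsets /offset; case: (_ < _) => //; rewrite -andbA.
move=> pa pb ab bb.
have [/eqP bm|bm] := boolP (b + b == m).
  have [b1|b1] := eqVneq b 1; last first.
    move: (pa) (pb); rewrite !posE => qa qb.
    apply: (@triple_exchange a b b b.-1 b.+1) => //;
      rewrite ?posE; move: m_ge2 mn n_le; lia.
  have [a1|a1] := eqVneq a 1.
    rewrite a1 b1; apply: cubic_reducible.
    by rewrite /critical_cubics -bm b1 (negPf n_neq3) inE.
  have an : a = n.-1 by move: ab; lia.
  have [n4|n4] := eqVneq n 4.
    apply: (reducible_perm (t := [:: 1; 1; 3])); first by rewrite an b1 n4.
    by apply: cubic_reducible; rewrite /critical_cubics -bm b1 n4.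
  have [n5|n5] := eqVneq n 5.
    apply: (reducible_perm (t := [:: 1; 1; 4])); first by rewrite an b1 n5.
    by apply: cubic_reducible; rewrite /critical_cubics -bm b1 n5.
  apply: (reducible_perm (t := [:: b; a; b]));
    first by rewrite perm_sym; apply: triple_perm1.
  apply: (@triple_exchange b a b 3 (n - 3)) => //;
      rewrite ?posE; move: mn n_neq3 n_le; lia.
have bn : b + b = n by move: bb; rewrite (negPf bm) => /eqP.
move: (pa) (pb); rewrite !posE => qa qb.
have [nm|nm] := eqVneq n m.+1; last first.
  apply: (@triple_exchange a b b 1 n.-1) => //;
      rewrite ?posE; move: m_ge2 mn n_le; lia.
have [m3|m3] := eqVneq m 3.
  have b2 : b = 2 by lia.
  have : (a == 1) || (a == 2) by lia.
  by case/orP => /eqP ->; apply: cubic_reducible; rewrite /critical_cubics m3 nm m3 b2.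
apply: (@triple_exchange a b b 2 (n - 2)) => //;
    rewrite ?posE; move: m_ge2 mn n_le; lia.
Qed.

(** Three pairwise sums with only two possible values: two of them agree, so
    two letters agree and [triple_repeated] applies. *)
Lemma triple_reducible a b c : pos a -> pos b -> pos c -> reducible [:: a; b; c].
Proof.
move=> pa pb pc.
have [ab|ab] := boolP ((a + b == m) || (a + b == n)); last first.
  apply: (reducible_perm (t := [:: c; a; b]));
    first by rewrite perm_sym; apply: triple_perm1.
  by apply/pair_cons_reducible/pair_reducible_generic => //; move: ab; clear; lia.
have [ac|ac] := boolP ((a + c == m) || (a + c == n)); last first.
  apply: (reducible_perm (t := [:: b; c; a])); first exact: triple_perm1.
  by apply/pair_cons_reducible/pair_reducible_generic => //; move: ac; clear; lia.
have [bc|bc] := boolP ((b + c == m) || (b + c == n)); last first.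
  by apply/pair_cons_reducible/pair_reducible_generic => //; move: bc; clear; lia.
have : [|| a == b, b == c | a == c] by move: ab ac bc; clear; lia.
case/or3P => /eqP H.
- apply: (reducible_perm (t := [:: c; a; b]));
    first by rewrite perm_sym; apply: triple_perm1.
  by rewrite -H in bc ab *; apply: triple_repeated; rewrite // addnC.
- by rewrite -H in bc *; apply: triple_repeated.
apply: (reducible_perm (t := [:: b; c; a])); first exact: triple_perm1.
by rewrite -H in bc ac *; apply: triple_repeated; rewrite // addnC.
Qed.

End NotTwoThree.

Section TwoThree.
Hypothesis n_eq3 : n = 3.

Let m_eq2 : m = 2. Proof. by move: m_ge2 mn; rewrite n_eq3; lia. Qed.

Let pos23 j : pos j = (j == 1) || (3 < j < e).
Proof.
by rewrite mem_positive_offsets /offset m_eq2 n_eq3; move: n_le n_eq3; clear; lia.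
Qed.

Lemma pair_reducible23 a b : pos a -> pos b -> a + b != 2 -> a + b != e + 3 ->
  reducible [:: a; b].
Proof.
move=> pa pb ab2 ab3; apply: pair_reducible => //.
- by rewrite m_eq2.
- by move: pa pb; rewrite !pos23 n_eq3; move: ab2; clear; lia.
by rewrite (negPf ab3) andbF.
Qed.

(** The degree 3e+3 has the normal word 1, 1, 1, with no letter 0. *)
Lemma pair_top23 a b : pos a -> pos b -> a + b = e + 3 ->
  [:: a; b] =~ [:: 1; 1; 1].
Proof.
move=> pa pb ab; have := pair_equivalent pa pb.
have -> : word_deg [:: a; b] = e * 3 + 3 by rewrite /word_deg /=; lia.
rewrite normal_wordE; last by move: n_le n_eq3; lia.
by rewrite -n_eq3 apery_word_n /top_word n_eq3 m_eq2.
Qed.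

Lemma one_reducible23 a : pos a -> a != 1 -> reducible [:: a; 1].
Proof.
by move=> pa a1; apply: pair_reducible23 => //; move: pa a1; rewrite !pos23; lia.
Qed.

(** Unless a pair reduces at once, all pairs have the sum e+3 and the letters
    agree; replacing two of them by 1, 1, 1 creates a pair that reduces. *)
Lemma triple_reducible23 a b c : pos a -> pos b -> pos c ->
  [:: a; b; c] != [:: 1; 1; 1] -> reducible [:: a; b; c].
Proof.
move=> pa pb pc ne.
have R x y : pos x -> pos y -> ~~ ((x == 1) && (y == 1)) ->
    x + y != e + 3 -> reducible [:: x; y].
  move=> px py xy; apply: pair_reducible23 => //.
  by move: px py xy; rewrite !pos23; clear; lia.
have [ab|ab] := boolP (~~ ((a == 1) && (b == 1)) && (a + b != e + 3)).
  apply: (reducible_perm (t := [:: c; a; b])).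
    by rewrite perm_sym; apply: triple_perm1.
  by apply: pair_cons_reducible => //; case/andP: ab => *; apply: R.
have [ac|ac] := boolP (~~ ((c == 1) && (a == 1)) && (c + a != e + 3)).
  apply: (reducible_perm (t := [:: b; c; a])); first exact: triple_perm1.
  by apply: pair_cons_reducible => //; case/andP: ac => *; apply: R.
have [bc|bc] := boolP (~~ ((b == 1) && (c == 1)) && (b + c != e + 3)).
  by apply: pair_cons_reducible => //; case/andP: bc => *; apply: R.
have [[ba ca] aa] : (b = a /\ c = a) /\ a + a = e + 3.
  move: pa pb pc ab ac bc ne; rewrite !eqseq_cons !pos23 andbT; clear; lia.
rewrite ba ca; apply: (reducible_trans (t := [:: a; 1; 1; 1])).
  exact: (equivalent_cat [:: a] (pair_top23 pa pa aa)).
apply: (reducible_perm (t := [:: 1; 1; a; 1])).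
  by rewrite -[[:: a; 1; 1; 1]]/([:: a; 1] ++ [:: 1; 1]) perm_catC.
apply: (@reducible_cat [:: 1; 1]); first by rewrite /= pos_offset // pos23.
by apply: one_reducible23 => //; move: aa n_le n_eq3; clear; lia.
Qed.

(** The words 1, 1, 1 and 4, e-1 are equivalent, and 1, 4 reduces. *)
Lemma quadruple_reducible23 d : pos d -> reducible [:: 1; 1; 1; d].
Proof.
move=> pd; have p1 : pos 1 by rewrite pos23.
have [->|d1] := eqVneq d 1; last first.
  apply: (@reducible_cat [:: 1; 1]); first by rewrite /= pos_offset.
  apply: (reducible_perm (t := [:: d; 1])); first by rewrite (perm_catC [:: 1] [:: d]).
  exact: one_reducible23.
have p4 : pos 4 by rewrite pos23; move: n_le n_eq3; clear; lia.
have pe : pos e.-1 by rewrite pos23; move: n_le n_eq3; clear; lia.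
apply: (reducible_trans (t := [:: 1; e.-1; 4])).
  apply/(equivalent_cat [:: 1])/equivalent_sym/pair_top23 => //.
  by move: n_le n_eq3; clear; lia.
apply: (reducible_perm (t := [:: e.-1; 4; 1])); first exact: triple_perm1.
exact/pair_cons_reducible/one_reducible23.
Qed.

End TwoThree.

(** For (2,3) the word 1, 1, 1 is itself an Apery word, so four letters may be
    needed before a reduction exists. *)
Lemma long_word s : all (fun j => pos j) s -> 2 < size s ->
  reducible s \/ normalizable s.
Proof.
have red3 a b c t : all (fun j => pos j) t -> reducible [:: a; b; c] ->
    reducible ([:: a, b, c & t]).
  move=> pt abc; apply: (reducible_perm (t := t ++ [:: a; b; c])).
    by rewrite -[[:: a, b, c & t]]/([:: a; b; c] ++ t) perm_catC.
  by apply: reducible_cat => //; apply: sub_all pt => j /pos_offset.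
case: s => [|a [|b [|c t]]] //= /and4P [pa pb pc pt] _.
have [n3|n3] := eqVneq n 3; last by left; apply: red3 => //; apply: triple_reducible.
have [[-> -> ->]|ne] := [:: a; b; c] =P [:: 1; 1; 1]; last first.
  by left; apply: red3 => //; apply: triple_reducible23 => //; apply/eqP.
case: t pt => [_|d t /= /andP [pd pt]].
  right; exists 0, 3; split; first by move: n_le n3; lia.
  rewrite -n3 apery_word_n /top_word n3 (_ : m = 2) /=; last by move: m_ge2 mn n3; lia.
  exact: equivalent_refl.
left; apply: (reducible_perm (t := t ++ [:: 1; 1; 1; d])).
  by rewrite -[[:: 1, 1, 1, d & t]]/([:: 1; 1; 1; d] ++ t) perm_catC.
apply: reducible_cat; first by apply: sub_all pt => j /pos_offset.
exact: quadruple_reducible23.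
Qed.

(** Induction on the degree: a reducible word loses a letter 0, and the other
    words are Apery words or pairs. *)
Lemma word_normalizable s : all offset s -> normalizable s.
Proof.
have e0 := e_gt0; have [d] := ubnP (word_deg s); elim: d s => // d IH s sd os.
have red : reducible s -> normalizable s.
  move=> [t [ot t0 st]]; have tp := perm_to_rem t0.
  have otr : all offset (rem 0 t) by rewrite (perm_all _ tp) in ot; case/andP: ot.
  have [|q [r [re tr]]] := IH (rem 0 t) _ otr.
    by move: sd st.2; rewrite (perm_word_deg tp) word_deg_cons; move: e0; clear; lia.
  exists q.+1, r; split=> //; apply: equivalent_trans st _.
  apply: equivalent_trans (equivalent_perm tp) _.
  exact: (equivalent_cat [:: 0] tr).
have [s0|s0] := boolP (0 \in s).
  by apply: red; exists s; split=> //; apply: equivalent_refl.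
have ps : all (fun j => pos j) s.
  apply/allP => j js; rewrite mem_positive_offsets (allP os _ js) andbT lt0n.
  by apply: contraNneq s0 => <-.
case: s s0 {sd IH os} red ps => [|a [|b [|c t]]] _ red ps.
- by exists 0, 0; split=> //; apply: equivalent_refl.
- move: ps; rewrite /= andbT mem_positive_offsets lt0n.
  move=> /andP [/negPf a0 /and3P [ae /negPf am /negPf an]].
  exists 0, a; split=> //; rewrite /apery_word a0 am an.
  exact: equivalent_refl.
- have /and3P [pa pb _] := ps.
  exists (word_deg [:: a; b] %/ e - size (apery_word (word_deg [:: a; b] %% e))).
  exists (word_deg [:: a; b] %% e); split; first by rewrite ltn_mod.
  exact: pair_equivalent.
by case: (long_word ps) => // /red.
Qed.

Lemma mono_normal_word u : E u (mono (normal_word (weighted_deg w u))).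
Proof.
have [s os ->] := mono_surj u; rewrite mono_deg //.
have [q [r [re [st ->]]]] := word_normalizable os.
by rewrite normal_word_shift.
Qed.

End Congruence.

Theorem sally_min_number_of_generators (k : fieldType) :
  min_number_of_generators w (@sally_ideal k e m n) (size critical_words).
Proof.
rewrite -(size_map mono).
apply: (toric_min_number_of_generators k (nf := fun d => mono (normal_word d))).
- exact: sally_gens_gt0.
- by rewrite map_inj_in_uniq ?critical_words_uniq //; apply: critical_words_mono_inj.
- move=> _ i /mapP [s sc ->] /mono_rem [si ->] v.
  have [os _ _ _] := critical_word_offset sc.
  have osr : all offset (rem (nth 0 G i - e) s).
    by move: os; rewrite (perm_all _ (perm_to_rem si)) => /andP [].
  have [t ot ->] := mono_surj v; rewrite !mono_deg //.
  by move/(critical_word_quotient sc si ot)/perm_mono.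
- by move=> u _; apply: normal_word_notin.
- move=> _ /mapP [s sc ->].
  have [os _ _ _] := critical_word_offset sc.
  rewrite (mono_deg os) mono_deg ?normal_word_offset //.
  by have [q [r [-> re rq _]]] := critical_word_deg sc; apply: normal_word_deg.
move=> E E_refl E_sym E_trans E_add E_crit u.
apply: (mono_normal_word (E := E)) => // s sc.
have [os _ _ _] := critical_word_offset sc.
by have := E_crit _ (map_f _ sc); rewrite mono_deg.
Qed.

End Words.

Theorem theorem4p8 (k : fieldType) (e m n : nat)
    (hm : 2 <= m) (hmn : m < n) (hn : n <= e - 2) :
  min_number_of_generators
    (@semigroup_gen (sally_gens e m n))
    (@sally_ideal k e m n)
    (if (m, n) \in [:: (2, 4); (2, 5); (3, 4)] then 'C(e - 2, 2)
     else if (m == 2) && ((n == 3) || (6 <= n)) then 'C(e - 2, 2) - 1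
     else 'C(e - 2, 2) - 2).
Proof.
rewrite -size_critical_words //; exact: sally_min_number_of_generators.
Qed.
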